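(* Let $G$ be a group, let $N$ and $M$ be normal subgroups of $G$ with $N\subseteq M$, and let $H$ be a subgroup of $G$ containing $N$ and $M$. Let $K$ and $T$ be the normal subgroups of $G$ with $N\subseteq K\subseteq H$ and $M\subseteq T\subseteq H$ such that $\underline{\operatorname{Apr}}_{G/N}(H/N)=K/N$ and $\underline{\operatorname{Apr}}_{G/M}(H/M)=T/M$. Then: (1) There is a group isomorphism $$\frac{G/N}{K/N}\to \frac{G/M}{T/M},\qquad xN(K/N)\mapsto xM(T/M).$$ In particular $G/K$ is isomorphic to $G/T$. (2) There is a group isomorphism $$\frac{H/N}{K/N}\to \frac{H/M}{T/M},\qquad xN(K/N)\mapsto xM(T/M).$$ In particular $H/K$ is isomorphic to $H/T$. (3) There is a surjective group homomorphism $$K/N\to T/M,\qquad xN\mapsto xM,$$ with kernel equal to $M/N$. In particular $M/N\subseteq K/N\subseteq H/N$ and $M\subseteq K\subseteq H$. (4) $K/M$ is isomorphic to $T/M$.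
   Context: For a group $G$ and a normal subgroup $P$ of $G$, conjugacy on $G/P$ is the relation $xP\sim yP$ iff $xP=(aya^{-1})P$ for some $a\in G$; the class of $xP$ is $[xP]=\{(axa^{-1})P : a\in G\}$. For a subset $H\subseteq G$ with $P\subseteq H$, $H/P:=\{hP : h\in H\}\subseteq G/P$, and the lower approximation of $H/P$ is $\underline{\operatorname{Apr}}_{G/P}(H/P)=\{xP\in G/P : [xP]\subseteq H/P\}$. When $H$ is a subgroup, $\underline{\operatorname{Apr}}_{G/P}(H/P)$ is a normal subgroup of $G/P$ contained in $H/P$, so by the correspondence theorem it has the form $L/P$ for a unique normal subgroup $L$ of $G$ with $P\subseteq L\subseteq H$; this is how $K$ (for $P=N$) and $T$ (for $P=M$) are defined. *)

(* Defs.v *)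
From HB Require Import structures.
From mathcomp Require Import all_boot.
From mathcomp Require Import boolp classical_sets functions.

Set Implicit Arguments.
Unset Strict Implicit.
Unset Printing Implicit Defensive.

Local Open Scope classical_set_scope.
Local Open Scope group_scope.

(* Groups are arbitrary (possibly infinite), so subgroups are classical sets
   in a [groupType]. *)
Definition is_subgroup (G : groupType) (H : set G) : Prop :=
  group_closed [in H].

Record normalSubgroup (G : groupType) := NormalSubgroup {
  normal_set :> set G;
  normal_is_subgroup : is_subgroup normal_set;
  normal_conj : forall a x, normal_set x -> normal_set (a * x * a^-1)
}.

Section NormalTheory.
Context (G : groupType) (N : normalSubgroup G).

Lemma normal1 : normal_set N 1.
Proof. by have [] := normal_is_subgroup N; rewrite in_setE. Qed.

Lemma normalV x : normal_set N x -> normal_set N x^-1.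
Proof.
move=> Nx; have := group_closedV (normal_is_subgroup N).
by move=> /(_ x); rewrite !in_setE; apply.
Qed.

Lemma normalM x y : normal_set N x -> normal_set N y -> normal_set N (x * y).
Proof.
move=> Nx Ny; have := group_closedM (normal_is_subgroup N).
by move=> /(_ x y); rewrite !in_setE; apply.
Qed.

Lemma normalJ a x : normal_set N x -> normal_set N (a^-1 * x * a).
Proof. by move=> /(normal_conj a^-1); rewrite invgK. Qed.

End NormalTheory.

Record quotient (G : groupType) (N : normalSubgroup G) := Quotient {
  coset_set :> set G;
  coset_setP : exists x, coset_set = [set x * n | n in N]
}.

HB.instance Definition _ (G : groupType) (N : normalSubgroup G) :=
  gen_eqMixin (quotient N).
HB.instance Definition _ (G : groupType) (N : normalSubgroup G) :=
  gen_choiceMixin (quotient N).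

Definition coset (G : groupType) (N : normalSubgroup G) (x : G) : quotient N :=
  Quotient (ex_intro _ x erefl).

Section QuotientGroup.
Context (G : groupType) (N : normalSubgroup G).
Implicit Types (x y : G) (X Y Z : quotient N).

Lemma quotient_inj X Y : coset_set X = coset_set Y -> X = Y.
Proof.
case: X Y => [X hX] [Y hY] /= XY; subst Y; congr Quotient; exact: Prop_irrelevance.
Qed.

Lemma coset_surj X : exists x, X = coset N x.
Proof. by have [x xP] := coset_setP X; exists x; apply: quotient_inj. Qed.

Lemma coset_eqP x y : coset N x = coset N y <-> normal_set N (x^-1 * y).
Proof.
split=> [xy|Nxy].
  have : coset_set (coset N y) y by exists 1; rewrite ?mulg1//; exact: normal1.
  by rewrite -xy => -[n Nn <-]; rewrite mulKg.
apply: quotient_inj; apply/seteqP; split=> z [n Nn <-].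
- exists (y^-1 * x * n); last by rewrite -mulgA mulVKg.
  apply: normalM => //.
  by rewrite -[y^-1 * x]invgK invgM invgK; exact: normalV.
- exists (x^-1 * y * n); last by rewrite -mulgA mulVKg.
  exact: normalM.
Qed.

Fact quotient_mul_subproof X Y :
  exists z, [set x * y | x in X & y in Y] = [set z * n | n in N].
Proof.
have [x ->] := coset_surj X; have [y ->] := coset_surj Y.
exists (x * y); apply/seteqP; split=> z.
- case=> _ [m Nm <-] [_ [n Nn <-] <-].
  exists (y^-1 * m * y * n); first by apply: normalM => //; exact: normalJ.
  by rewrite !mulgA mulgK.
- case=> n Nn <-; exists x; first by exists 1; rewrite ?mulg1//; exact: normal1.
  by exists (y * n); rewrite ?mulgA//; exists n.
Qed.

Fact quotient_inv_subproof X :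
  exists z, [set x^-1 | x in X] = [set z * n | n in N].
Proof.
have [x ->] := coset_surj X; exists x^-1; apply/seteqP; split=> z.
- case=> _ [m Nm <-] <-; exists (x * m^-1 * x^-1); last by rewrite invgM !mulgA mulVg mul1g.
  by apply: normal_conj; exact: normalV.
- case=> n Nn <-; exists (x * (x^-1 * n^-1 * x)); last by rewrite !mulgA mulgV mul1g invgM invgK.
  by exists (x^-1 * n^-1 * x) => //; apply: normalJ; exact: normalV.
Qed.

Definition quotient_one : quotient N := coset N 1.
Definition quotient_mul X Y : quotient N := Quotient (quotient_mul_subproof X Y).
Definition quotient_inv X : quotient N := Quotient (quotient_inv_subproof X).

Lemma quotient_mulE x y :
  quotient_mul (coset N x) (coset N y) = coset N (x * y).
Proof.
have [z zP] := coset_surj (quotient_mul (coset N x) (coset N y)).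
rewrite zP; apply/coset_eqP.
have : coset_set (quotient_mul (coset N x) (coset N y)) (x * y).
  exists x; first by exists 1; rewrite ?mulg1//; exact: normal1.
  by exists y => //; exists 1; rewrite ?mulg1//; exact: normal1.
by rewrite zP => -[n Nn <-]; rewrite mulKg.
Qed.

Lemma quotient_invE x : quotient_inv (coset N x) = coset N x^-1.
Proof.
have [z zP] := coset_surj (quotient_inv (coset N x)).
rewrite zP; apply/coset_eqP.
have : coset_set (quotient_inv (coset N x)) x^-1.
  by exists x => //; exists 1; rewrite ?mulg1//; exact: normal1.
by rewrite zP => -[n Nn <-]; rewrite mulKg.
Qed.

Fact quotient_mulA : associative quotient_mul.
Proof.
move=> X Y Z; have [x ->] := coset_surj X; have [y ->] := coset_surj Y.
by have [z ->] := coset_surj Z; rewrite !quotient_mulE mulgA.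
Qed.

Fact quotient_mul1g : left_id quotient_one quotient_mul.
Proof. by move=> X; have [x ->] := coset_surj X; rewrite quotient_mulE mul1g. Qed.

Fact quotient_mulg1 : right_id quotient_one quotient_mul.
Proof. by move=> X; have [x ->] := coset_surj X; rewrite quotient_mulE mulg1. Qed.

Fact quotient_mulVg : left_inverse quotient_one quotient_inv quotient_mul.
Proof.
by move=> X; have [x ->] := coset_surj X; rewrite quotient_invE quotient_mulE mulVg.
Qed.

Fact quotient_mulgV : right_inverse quotient_one quotient_inv quotient_mul.
Proof.
by move=> X; have [x ->] := coset_surj X; rewrite quotient_invE quotient_mulE mulgV.
Qed.

HB.instance Definition _ := isGroup.Build (quotient N)
  quotient_mulA quotient_mul1g quotient_mulg1 quotient_mulVg quotient_mulgV.

Lemma cosetM x y : coset N (x * y) = coset N x * coset N y.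
Proof. by rewrite -quotient_mulE. Qed.

Lemma cosetV x : coset N x^-1 = (coset N x)^-1.
Proof. by rewrite -quotient_invE. Qed.

End QuotientGroup.

(* A / P, as a subset of G / P *)
Definition quo (G : groupType) (A : set G) (P : normalSubgroup G) :
  set (quotient P) := [set coset P a | a in A].
Arguments quo {G} A P.

(* The underlying set of [quo_normal K P] is convertible to [quo K P]. *)
Section QuoNormal.
Context (G : groupType) (K P : normalSubgroup G).

Fact quo_is_subgroup : is_subgroup (quo K P).
Proof.
split=> [|X Y]; first by rewrite in_setE; exists 1 => //; exact: normal1.
rewrite !in_setE => -[x Kx <-] [y Ky <-].
exists (x / y); last by rewrite cosetM cosetV.
by apply: normalM => //; exact: normalV.
Qed.

Fact quo_conj (a x : quotient P) : quo K P x -> quo K P (a * x * a^-1).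
Proof.
move=> [y Ky <-]; have [b ->] := coset_surj a.
by exists (b * y * b^-1); rewrite ?cosetM ?cosetV//; exact: normal_conj.
Qed.

Definition quo_normal : normalSubgroup (quotient P) :=
  NormalSubgroup quo_is_subgroup quo_conj.

End QuoNormal.

(* The class [xP] of the coset xP *)
Definition conj_class (G : groupType) (P : normalSubgroup G) (x : G) :
  set (quotient P) := [set coset P (a * x * a^-1) | a in [set: G]].
Arguments conj_class {G} P x.

Definition lower_apr (G : groupType) (P : normalSubgroup G)
  (A : set (quotient P)) : set (quotient P) :=
  [set coset P x | x in [set x | conj_class P x `<=` A]].

(* Maps between subgroups are total functions of the ambient groups, of which
   only the restriction to A matters. *)
Definition group_hom (G1 G2 : groupType) (A : set G1) (B : set G2)
  (f : G1 -> G2) : Prop :=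
  set_fun A B f /\ {in A &, {morph f : x y / x * y}}.

Definition group_iso (G1 G2 : groupType) (A : set G1) (B : set G2)
  (f : G1 -> G2) : Prop := group_hom A B f /\ set_bij A B f.

Definition isomorphic (G1 G2 : groupType) (A : set G1) (B : set G2) : Prop :=
  exists f : G1 -> G2, group_iso A B f.

(* Main.v *)
Require Import Defs.
From mathcomp Require Import all_boot.
From mathcomp Require Import boolp classical_sets functions.

Local Open Scope classical_set_scope.
Local Open Scope group_scope.

(** Both K and T are the normal core of H, i.e. the set of those x all of whose
conjugates lie in H. Indeed, if P is normal in G and contained in H, then
yP lies in H/P exactly when y lies in H, so the class of xP is contained in
H/P exactly when x lies in the core: the lower approximation of H/P is
core(H)/P (lemma [lower_apr_quo]), whatever P is. A subgroup containing P is
recovered from its image in G/P (lemma [quo_inj]), hence K = core(H) = T; in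
particular K contains M, because T does.

Once T is replaced by K, the identity is an isomorphism from G/K to G/T, from
H/K to H/T and from K/M to T/M. The maps given by a formula on cosets are all
instances of one construction ([quotient_map]), the map G/P -> G'/P' induced by a morphism
G -> G' sending P into P': first G/N -> G/M is induced by the identity of G, and
then (G/N)/(K/N) -> (G/M)/(K/M) is induced by G/N -> G/M. The latter is
injective because K/N is the whole preimage of K/M, by M being contained in K;
its restriction to any subset is then an isomorphism onto the image. *)

(** * Subgroups containing P and their images in G/P *)

Lemma subgroup1 {G : groupType} {A : set G} : is_subgroup A -> A 1.
Proof. by case; rewrite in_setE. Qed.

Lemma subgroupM {G : groupType} {A : set G} {x y : G} :
  is_subgroup A -> A x -> A y -> A (x * y).
Proof.
by move=> gA Ax Ay; move: (group_closedM gA) => /(_ x y); rewrite !in_setE; apply.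
Qed.

Lemma subgroupV {G : groupType} {A : set G} {x : G} :
  is_subgroup A -> A x -> A x^-1.
Proof. by move=> gA Ax; move: (group_closedV gA) => /(_ x); rewrite !in_setE; apply. Qed.

Lemma coset_eq1 {G : groupType} (P : normalSubgroup G) (x : G) :
  coset P x = 1 <-> normal_set P x.
Proof.
rewrite -[1]/(coset P 1) coset_eqP mulg1.
by split=> /normalV //; rewrite invgK.
Qed.

Lemma quo_coset {G : groupType} {P : normalSubgroup G} {A : set G} (x : G) :
  is_subgroup A -> P `<=` A -> quo A P (coset P x) <-> A x.
Proof.
move=> gA PA; split=> [[a Aa /coset_eqP Pax]|Ax]; last by exists x.
by rewrite -(mulVKg a x); apply: subgroupM => //; exact: PA.
Qed.

Lemma quo_inj {G : groupType} {P : normalSubgroup G} {A B : set G} :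
  is_subgroup A -> is_subgroup B -> P `<=` A -> P `<=` B ->
  quo A P = quo B P -> A = B.
Proof.
move=> gA gB PA PB AB; apply/seteqP; split=> x.
- by move/(quo_coset x gA PA); rewrite AB => /(quo_coset x gB PB).
- by move/(quo_coset x gB PB); rewrite -AB => /(quo_coset x gA PA).
Qed.

Lemma normalSubgroup_inj {G : groupType} (K T : normalSubgroup G) :
  normal_set K = normal_set T -> K = T.
Proof.
case: K T => [K gK cK] [T gT cT] /= KT; subst T.
by congr NormalSubgroup; exact: Prop_irrelevance.
Qed.

(** * Lower approximations and the normal core *)

Definition normal_core {G : groupType} (A : set G) : set G :=
  [set x | forall a, A (a * x * a^-1)].

Lemma normal_core_subgroup {G : groupType} (A : set G) :
  is_subgroup A -> is_subgroup (normal_core A).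
Proof.
move=> gA; split=> [|x y]; rewrite !in_setE.
  by move=> a; rewrite mulg1 mulgV; exact: subgroup1.
move=> Ax Ay a.
have -> : a * (x / y) * a^-1 = (a * x * a^-1) * (a * y * a^-1)^-1.
  by rewrite !invgM invgK !mulgA mulgVK.
by apply: subgroupM => //; exact: subgroupV.
Qed.

Lemma sub_normal_core {G : groupType} {P : normalSubgroup G} {A : set G} :
  P `<=` A -> P `<=` normal_core A.
Proof. by move=> PA x Px a; apply: PA; exact: normal_conj. Qed.

(** Since A contains P, testing membership in A/P is testing membership of a
representative in A; hence the class of xP lies in A/P iff every conjugate of x
lies in A. *)
Lemma lower_apr_quo {G : groupType} {P : normalSubgroup G} {A : set G} :
  is_subgroup A -> P `<=` A -> lower_apr (quo A P) = quo (normal_core A) P.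
Proof.
move=> gA PA; apply/seteqP; split=> _ [x xA <-]; exists x => //.
- by move=> a; apply/(quo_coset _ gA PA); apply: xA; exists a.
- by move=> _ [a _ <-]; exists (a * x * a^-1).
Qed.

Lemma lower_apr_core {G : groupType} {P L : normalSubgroup G} {A : set G} :
  is_subgroup A -> P `<=` A -> P `<=` L ->
  lower_apr (quo A P) = quo L P -> normal_set L = normal_core A.
Proof.
move=> gA PA PL; rewrite lower_apr_quo // => /esym; apply: quo_inj => //.
- exact: normal_is_subgroup.
- exact: normal_core_subgroup.
- exact: sub_normal_core.
Qed.

(** * Maps induced on quotients *)

(** The image of a coset is computed on an arbitrarily chosen representative;
when phi is a morphism sending P into P', the choice does not matter, by
[quotient_map_coset]. *)
Definition quotient_map {G G' : groupType} (P : normalSubgroup G)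
    (P' : normalSubgroup G') (phi : G -> G') (X : quotient P) : quotient P' :=
  coset P' (phi (sval (cid (coset_surj X)))).

Section QuotientMap.
Context {G G' : groupType} {P : normalSubgroup G} {P' : normalSubgroup G'}.
Context {phi : G -> G'} (phiM : {morph phi : x y / x * y}).
Context (phiP : forall x, normal_set P x -> normal_set P' (phi x)).
Local Notation f := (quotient_map P P' phi).

Lemma morphVM (x y : G) : phi (x^-1 * y) = (phi x)^-1 * phi y.
Proof. by apply: (mulgI (phi x)); rewrite mulVKg -phiM mulVKg. Qed.

Lemma quotient_map_coset (x : G) : f (coset P x) = coset P' (phi x).
Proof.
rewrite /quotient_map; case: cid => y /= /esym /coset_eqP Pyx.
by apply/coset_eqP; rewrite -morphVM; exact: phiP.
Qed.

Lemma quotient_mapM : {morph f : X Y / X * Y}.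
Proof.
move=> X Y; have [x ->] := coset_surj X; have [y ->] := coset_surj Y.
by rewrite -cosetM !quotient_map_coset phiM cosetM.
Qed.

Lemma quotient_map_inj :
  (forall x, normal_set P' (phi x) -> normal_set P x) -> injective f.
Proof.
move=> phiI X Y; have [x ->] := coset_surj X; have [y ->] := coset_surj Y.
rewrite !quotient_map_coset => /coset_eqP; rewrite -morphVM => /phiI Pxy.
exact/coset_eqP.
Qed.

Lemma quotient_map_quo (A : set G) (B : set G') :
  phi @` A = B -> f @` quo A P = quo B P'.
Proof.
move=> <-; rewrite /quo !image_comp; apply: eq_imagel => x _ /=.
exact: quotient_map_coset.
Qed.

End QuotientMap.

Lemma quo_setT {G : groupType} (P : normalSubgroup G) :
  quo [set: G] P = [set: quotient P].
Proof.
by apply/seteqP; split=> // X _; have [x ->] := coset_surj X; exists x.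
Qed.

Lemma group_iso_image {G G' : groupType} (f : G -> G') (A : set G)
    (B : set G') :
  {morph f : x y / x * y} -> injective f -> f @` A = B -> group_iso A B f.
Proof.
move=> fM fI <-; split; [split|split].
- by move=> x Ax; exists x.
- by move=> x y _ _; exact: fM.
- by move=> x Ax; exists x.
- by move=> x y _ _; exact: fI.
- by [].
Qed.

Lemma isomorphic_refl {G : groupType} (A : set G) : isomorphic A A.
Proof. by exists id; apply: group_iso_image => //; exact: image_id. Qed.

Theorem theorem3p4 (G : groupType) (N M : normalSubgroup G) (H : set G)
    (NM : N `<=` M) (Hgroup : is_subgroup H) (NH : N `<=` H) (MH : M `<=` H)
    (K T : normalSubgroup G)
    (NK : N `<=` K) (KH : K `<=` H) (MT : M `<=` T) (TH : T `<=` H)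
    (aprK : lower_apr (quo H N) = quo K N)
    (aprT : lower_apr (quo H M) = quo T M) :
  [/\ (* (1) *)
      (exists f : quotient (quo_normal K N) -> quotient (quo_normal T M),
         group_iso [set: quotient (quo_normal K N)]
                   [set: quotient (quo_normal T M)] f /\
         (forall x : G, f (coset (quo_normal K N) (coset N x)) =
                        coset (quo_normal T M) (coset M x))) /\
      isomorphic [set: quotient K] [set: quotient T],
      (* (2) *)
      (exists f : quotient (quo_normal K N) -> quotient (quo_normal T M),
         group_iso (quo (quo H N) (quo_normal K N))
                   (quo (quo H M) (quo_normal T M)) f /\
         (forall x : G, H x -> f (coset (quo_normal K N) (coset N x)) =
                               coset (quo_normal T M) (coset M x))) /\
      isomorphic (quo H K) (quo H T),
      (* (3) *)
      [/\ exists f : quotient N -> quotient M,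
            [/\ group_hom (quo K N) (quo T M) f,
                set_surj (quo K N) (quo T M) f,
                forall x : G, normal_set K x -> f (coset N x) = coset M x &
                [set X | quo K N X /\ f X = 1] = quo M N],
          quo M N `<=` quo K N, quo K N `<=` quo H N, M `<=` K & K `<=` H] &
      (* (4) *)
      isomorphic (quo K M) (quo T M)].
Proof.
have KT : K = T.
  apply: normalSubgroup_inj.
  by rewrite (lower_apr_core Hgroup NH NK aprK) (lower_apr_core Hgroup MH MT aprT).
subst T; have MK := MT.
pose p : quotient N -> quotient M := quotient_map N M id.
have pE x : p (coset N x) = coset M x by exact: quotient_map_coset.
have pM : {morph p : X Y / X * Y} by exact: quotient_mapM.
have p_quo A : p @` quo A N = quo A M.
  by apply: quotient_map_quo => //; exact: image_id.
have p_K X : quo K N X -> quo K M (p X) by rewrite -p_quo => KX; exists X.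
have p_KV X : quo K M (p X) -> quo K N X.
  have [x ->] := coset_surj X; rewrite pE.
  by move=> /(quo_coset x (normal_is_subgroup K) MK) Kx; exists x.
pose q := quotient_map (quo_normal K N) (quo_normal K M) p.
have qE x : q (coset _ (coset N x)) = coset _ (coset M x).
  by rewrite /q quotient_map_coset // pE.
have q_iso A : group_iso (quo (quo A N) (quo_normal K N))
                         (quo (quo A M) (quo_normal K M)) q.
  apply: group_iso_image; first exact: quotient_mapM.
  - exact: quotient_map_inj.
  - exact: quotient_map_quo.
split; last exact: isomorphic_refl.
- split; last exact: isomorphic_refl.
  by exists q; split=> //; have := q_iso setT; rewrite !quo_setT.
- by split; [exists q|exact: isomorphic_refl].
- split=> //; try exact: image_subset.
  exists p; split=> //.
  + by split=> // X Y _ _; exact: pM.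
  + by rewrite /set_surj p_quo.
  + apply/seteqP; split=> X [].
    * by move=> [x Kx <-]; rewrite pE => /coset_eq1 Mx; exists x.
    * move=> x Mx <-; split; first by exists x => //; exact: MK.
      by rewrite pE; apply/coset_eq1.
Qed.
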